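(* Let $T_M,c>0$. Then there exists a solution $f\in C^{2,1/2}(\mathbb R_+)$, with $f>0$ in the interior of $\mathbb R_+$, of $$f''(y)-cf'(y)-f^4(y)=-\int_0^\infty E(y-\eta)f^4(\eta)\,d\eta\ \ (y>0),\qquad f(0)=T_M,\qquad f\ge0.$$ Moreover, $f$ is the limit of a monotone increasing bounded sequence $0\le f_1\le f_2\le\dots\le f_n\le f_{n+1}\le\dots\le T_M$ with $f_n\in C^{2,1/2}(\mathbb R_+)$, $\|f_n\|_{2,1/2}$ uniformly bounded and $f_n>0$ in the interior of $\mathbb R_+$, solving the recursive system $$f_{n+1}''-cf_{n+1}'-f_{n+1}^4=-\int_0^\infty E(y-\eta)f_n^4(\eta)\,d\eta\ \ (y>0,\ n\ge0),\qquad f_0=0,\qquad f_{n+1}(0)=T_M,\qquad f_{n+1}\ge0.$$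
   Context: $E(x)=\frac12E_1(x)=\frac12\int_{|x|}^\infty\frac{e^{-t}}{t}dt$. $\mathbb R_+=[0,\infty)$. $C^{k,\beta}(U)$ denotes $k$ times continuously differentiable functions with finite norm $\|f\|_{k,\beta}=\max_{0\le j\le k}\sup_U|\partial^jf|+\sup_{x\ne y}\frac{|\partial^kf(x)-\partial^kf(y)|}{|x-y|^\beta}$. *)

(* Defs.v *)
From HB Require Import structures.
From mathcomp Require Import all_boot all_order all_algebra.
From mathcomp Require Import all_classical all_reals all_analysis.
Set Implicit Arguments. Unset Strict Implicit. Unset Printing Implicit Defensive.
Import Order.TTheory GRing.Theory Num.Theory.
Import numFieldNormedType.Exports.
Local Open Scope classical_set_scope.
Local Open Scope ring_scope.

Section Defs.
Variable R : realType.

(* E(x) = 1/2 E_1(x) = 1/2 \int_{|x|}^oo e^{-t}/t dt, as an extended real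
   (it equals +oo at x = 0). *)
Definition Ekernel (x : R) : \bar R :=
  ((2^-1)%:E * \int[@lebesgue_measure R]_(t in `](Num.norm x)%R, +oo[) (expR (- t) / t)%R%:E)%E.

Definition Eint (g : R -> R) (y : R) : \bar R :=
  (\int[@lebesgue_measure R]_(eta in `[0%R, +oo[) (Ekernel (y - eta)%R * (g eta ^+ 4)%R%:E))%E.

(* g is the derivative of f on R_+ = [0,oo): one-sided at 0, two-sided for y > 0. *)
Definition deriv_Rplus (f g : R -> R) : Prop :=
  forall y : R, 0 <= y ->
    (fun h : R => h^-1 * (f (y + h) - f y)) @ within [set h : R | 0 <= y + h] (0 : R)^'
      --> g y.

(* f in C^{2,beta}(R_+) with derivatives f1 = f', f2 = f'' and
   ||f||_{2,beta} <= M (the norm is a max of the four quantities below). *)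
Definition C2beta_bound (f f1 f2 : R -> R) (beta M : R) : Prop :=
  [/\ deriv_Rplus f f1, deriv_Rplus f1 f2,
      (forall x, 0 <= x -> [/\ `|f x| <= M, `|f1 x| <= M & `|f2 x| <= M]) &
      (forall x y, 0 <= x -> 0 <= y -> x != y ->
         `|f2 x - f2 y| / (`|x - y| `^ beta) <= M)].

Definition solves_eq (c : R) (f f1 f2 g : R -> R) : Prop :=
  forall y : R, 0 < y ->
    ((f2 y - c * f1 y - f y ^+ 4)%:E = - Eint g y)%E.

End Defs.

(* Main.v *)
Require Import Defs.
From HB Require Import structures.
From mathcomp Require Import all_boot all_order all_algebra.
From mathcomp Require Import all_classical all_reals all_analysis.
From mathcomp Require Import measurable_realfun ring lra.
Set Implicit Arguments. Unset Strict Implicit. Unset Printing Implicit Defensive.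
Import Order.TTheory GRing.Theory Num.Theory.
Import numFieldNormedType.Exports.
Local Open Scope classical_set_scope.
Local Open Scope ring_scope.

(* Pick [a, b > 0] with [b - a = c] and [a b >= 4 T^3].  Then
   [u'' - c u' - a b u = (d/dy - b) (d/dy + a) u], and the equation with source
   [h = E * g^4] reads [- (d/dy - b) (d/dy + a) u = a b u - u^4 + h].  Inverting
   the two first-order factors (the first one among bounded functions, the second
   one with [u 0 = T]) turns it into [u = step u g].  Since [s |-> a b s - s^4] is
   nondecreasing on [0, T] and both inverses are positive, [step] is monotone in
   [u] and [g]; since [E] has mass 1, the constant [T] is a supersolution.
   Iterating from [0] gives the minimal solution for each [g]; it is monotone in
   [g], so the outer iteration [f_{n+1} = minimal_solution f_n] increases too, and
   dominated convergence passes [f_{n+1} = step f_{n+1} f_n] to the limit.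
   Tonelli writes [h y] as [1/2 \int_t e^-t / t \int_{eta >= 0, |y - eta| < t}
   g^4], which gives both [h <= T^4] and the Hoelder-1/2 bound on [h] that is
   inherited by [u'' = c u' + u^4 - h]. *)

(** * Derivatives, improper integrals and dominated convergence on the real line *)

Section calculus.
Context {R : realType}.
Notation mu := (@lebesgue_measure R).
Implicit Types (f g F S : R -> R) (x y k B : R).

Lemma is_derive_expRM k x :
  is_derive x 1 (fun y => expR (k * y)) (k * expR (k * x)).
Proof.
have dk : is_derive x 1 (fun y : R => k * y) k.
  by rewrite -[X in is_derive _ _ _ X](mulr1 k); exact: is_deriveZ.
by rewrite mulrC; exact: (is_derive1_comp (is_derive_expR _) dk).
Qed.

Lemma is_derive_continuous f x d : is_derive x 1 f d -> {for x, continuous f}.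
Proof.
by move=> [df _]; apply: differentiable_continuous; exact/derivable1_diffP.
Qed.

Lemma continuous_expRM k : continuous (fun y : R => expR (k * y)).
Proof. by move=> x; exact: (is_derive_continuous (is_derive_expRM k x)). Qed.

Lemma cvg_expRNM k : 0 < k -> expR (- k * x) @[x --> +oo] --> (0 : R).
Proof.
move=> k0.
rewrite (_ : (fun x => expR (- k * x)) =
             (fun z => expR (- z)) \o (fun z => k * z)); last first.
  by apply: eq_fun => x; rewrite mulNr.
apply: (@cvg_comp _ _ _ _ _ _ (pinfty_nbhs R)); last exact: cvgr_expR.
exact: gt0_cvgMry.
Qed.

Lemma derive1_is_derive f x d : is_derive x 1 f d -> derive1 f x = d.
Proof. by move=> df; rewrite derive1E; exact: derive_val. Qed.

(** Serves two improper integrals: the exponential tail in [integral_expRN] and the tail of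
    [(t + d)^(-3/2)] in [integral_expr32]. *)
Lemma ge0_is_derive_FTC2y f F x l :
  (forall y, x <= y -> 0 <= f y) ->
  (forall y, x <= y -> {for y, continuous f}) ->
  (forall y, x <= y -> is_derive y 1 F (f y)) ->
  F y @[y --> +oo] --> l ->
  (\int[mu]_(y in `[x, +oo[) (f y)%:E = l%:E - (F x)%:E)%E.
Proof.
move=> f0 cf dF Fl; apply: ge0_continuous_FTC2y => //.
- apply/continuous_within_itvcyP; split.
    by move=> y; rewrite in_itv/= andbT => xy; exact/cf/ltW.
  by apply: cvg_at_right_filter; exact: cf.
- by move=> y /ltW/dF[].
- by apply: cvg_at_right_filter; exact: (is_derive_continuous (dF _ _)).
- move=> y; rewrite in_itv/= andbT => /ltW/dF; exact: derive1_is_derive.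
Qed.

Lemma is_derive_FTC2 f F x y : x <= y -> continuous f ->
  (forall z : R, is_derive z 1 F (f z)) ->
  \int[mu]_(z in `[x, y]) f z = F y - F x.
Proof.
rewrite le_eqVlt => /predU1P[<- _ _|xy cf dF].
  by rewrite set_itv1 Rintegral_set1 subrr.
rewrite /Rintegral (@continuous_FTC2 _ _ F)//.
- exact: continuous_subspaceT.
- split.
  + by move=> z _; have [] := dF z.
  + by apply: cvg_at_right_filter; exact: (is_derive_continuous (dF _)).
  + by apply: cvg_at_left_filter; exact: (is_derive_continuous (dF _)).
- by move=> z _; exact: derive1_is_derive.
Qed.

Lemma continuous_integrable_itv f x y : continuous f ->
  mu.-integrable `[x, y] (EFin \o f).
Proof.
move=> cf; apply: continuous_compact_integrable; first exact: segment_compact.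
exact: continuous_subspaceT.
Qed.

(* The base point is kept below [x], so that the derivative is two-sided. *)
Lemma is_derive_Rintegral f x0 x : x0 < x -> continuous f ->
  is_derive x 1 (fun y => \int[mu]_(t in `[x0, y]) f t) (f x).
Proof.
move=> x0x cf.
have xx1 : x < x + 1 by rewrite ltrDl.
have [df dfE] := continuous_FTC1_closed xx1
  (@continuous_integrable_itv f x0 (x + 1) cf) x0x (cf x).
by apply: DeriveDef; [exact: df|rewrite -derive1E; exact: dfE].
Qed.

Lemma is_derive_lipschitz F f x y B :
  (forall z : R, x <= z <= y -> is_derive z 1 F (f z)) ->
  (forall z, x <= z <= y -> `|f z| <= B) -> x <= y ->
  `|F y - F x| <= B * (y - x).
Proof.
move=> dF fB xy.
have dF' z : z \in `]x, y[ -> is_derive z 1 F (f z).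
  by rewrite in_itv/= => /andP[/ltW xz /ltW zy]; apply: dF; rewrite xz zy.
have cF : {within `[x, y], continuous F}.
  by apply: derivable_within_continuous => z; rewrite in_itv/= => /dF[].
have [z + ->] := MVT_segment xy dF' cF.
rewrite in_itv/= => zxy; rewrite normrM (ger0_norm (_ : 0 <= y - x)) ?subr_ge0//.
by rewrite ler_wpM2r ?subr_ge0// fB.
Qed.

Lemma Rintegral_dominated_cvg (D : set R) (f_ : nat -> R -> R) f g :
  measurable D -> (forall n, measurable_fun D (f_ n)) ->
  (forall x, D x -> f_ n x @[n --> \oo] --> f x) ->
  mu.-integrable D (EFin \o g) ->
  (forall n x, D x -> `|f_ n x| <= g x) ->
  \int[mu]_(x in D) f_ n x @[n --> \oo] --> \int[mu]_(x in D) f x.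
Proof.
move=> mD mf_ f_f ig f_g.
have f_fE x : D x -> (EFin \o f_ n) x @[n --> \oo] --> (EFin \o f) x.
  by move=> Dx; apply: cvg_EFin; [exact: nearW|exact: f_f].
have mf_E n : measurable_fun D (fun x => (f_ n x)%:E) by exact/measurable_EFinP.
have mf : measurable_fun D (fun x => (f x)%:E).
  exact: (emeasurable_fun_cvg _ _ mf_E f_fE).
have fg x : D x -> `|f x| <= g x.
  move=> Dx; apply: (@cvgr_to_le _ \oo _ _ (fun n => `|f_ n x|)).
    by apply: cvg_norm; exact: f_f.
  by apply: nearW => n; exact: f_g.
apply: fine_cvg; rewrite fineK; last first.
  apply: integrable_fin_num => //; apply: le_integrable ig => //.
  by move=> x Dx /=; rewrite lee_fin (le_trans (fg _ Dx))// ler_norm.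
by apply: (@dominated_cvg _ _ _ mu D mD _ _ (EFin \o g)).
Qed.

End calculus.

(** * Inverses of the first-order operators [b - d/dy] and [d/dy + a] *)

Section resolvents.
Context {R : realType}.
Notation mu := (@lebesgue_measure R).
Implicit Types (S v : R -> R) (a b x y B T : R).

(* For bounded [S], the bounded solution [w] of [w' = b w - S]. *)
Definition tail_resolvent b S y : R :=
  expR (b * y) * \int[mu]_(t in `]y, +oo[) (expR (- b * t) * S t).

(* The solution [u] of [u' = v - a u], [u 0 = T] on [y > -1]; the base point
   [-1] makes the derivative at [0] two-sided. *)
Definition head_resolvent a T v y : R :=
  expR (- a * y) * (T + (\int[mu]_(s in `[-1, y]) (expR (a * s) * v s)
                       - \int[mu]_(s in `[-1, 0]) (expR (a * s) * v s))).

Let expRM_N a y : expR (a * y) * expR (- a * y) = 1.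
Proof. by rewrite -expRD mulNr subrr expR0. Qed.

Lemma integral_expRN b y : 0 < b ->
  (\int[mu]_(t in `[y, +oo[) (expR (- b * t))%:E = (expR (- b * y) / b)%:E)%E.
Proof.
move=> b0; pose F t := - (b^-1 * expR (- b * t)).
rewrite (_ : (expR (- b * y) / b)%:E = 0%:E - (F y)%:E)%E; last first.
  by rewrite sub0e -EFinN opprK mulrC.
apply: ge0_is_derive_FTC2y.
- by move=> t _; exact: expR_ge0.
- by move=> t _; exact: continuous_expRM.
- move=> t _.
  rewrite [X in is_derive _ _ _ X](_ : _ = - (b^-1 * (- b * expR (- b * t)))).
    by apply: is_deriveN; apply: is_deriveZ; exact: is_derive_expRM.
  by rewrite mulrA mulrN mulVf ?gt_eqF// mulN1r opprK.
- rewrite -oppr0; apply: cvgN; rewrite -[X in _ --> X](mulr0 b^-1).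
  by apply: cvgMr; exact: cvg_expRNM.
Qed.

Lemma integrable_expRN b y : 0 < b ->
  mu.-integrable `[y, +oo[ (EFin \o (fun t => expR (- b * t))).
Proof.
move=> b0; apply/integrableP; split.
  apply/measurable_EFinP; apply: measurable_funTS.
  by apply: continuous_measurable_fun; exact: continuous_expRM.
under eq_integral do rewrite gee0_abs ?lee_fin ?expR_ge0//.
by rewrite integral_expRN// ltry.
Qed.

(** * The backward factor, solved by integrating from infinity *)

Section tail.
Variables (b B : R).
Hypothesis b0 : 0 < b.

Let B0 S : (forall x, `|S x| <= B) -> 0 <= B.
Proof. by move=> /(_ 0); exact: le_trans. Qed.

Let mS S : continuous S -> measurable_fun setT (fun t => expR (- b * t) * S t).
Proof.
move=> cS; apply: measurable_funM; apply: continuous_measurable_fun => //.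
exact: continuous_expRM.
Qed.

Lemma integrable_expRNM S y : continuous S -> (forall x, `|S x| <= B) ->
  mu.-integrable `[y, +oo[ (EFin \o (fun t => expR (- b * t) * S t)).
Proof.
move=> cS SB.
have ig : mu.-integrable `[y, +oo[ (EFin \o (fun t => B * expR (- b * t))).
  rewrite (_ : _ \o _ = fun t => (B%:E * (expR (- b * t))%:E)%E); last first.
    by apply/funext => t /=; rewrite EFinM.
  by apply: integrableZl => //; exact: integrable_expRN.
apply: le_integrable ig => //.
- by apply/measurable_EFinP; apply: measurable_funTS; exact: mS.
- move=> t _ /=; rewrite lee_fin normrM mulrC [leRHS]ger0_norm; last first.
    by rewrite mulr_ge0 ?expR_ge0 ?(B0 SB).
  by rewrite (ger0_norm (expR_ge0 _)) ler_wpM2r ?expR_ge0.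
Qed.

Let integrable_oc S y : continuous S -> (forall x, `|S x| <= B) ->
  mu.-integrable `]y, +oo[ (EFin \o (fun t => expR (- b * t) * S t)).
Proof.
move=> cS SB; apply: integrableS (integrable_expRNM y cS SB) => //.
by apply: subset_itvr; rewrite bnd_simp.
Qed.

(** Near [y] the tail integral is a constant minus an integral from [y - 1], so the fundamental
    theorem of calculus applies at an interior point, and the product rule finishes. *)
Lemma is_derive_tail_resolvent S y : continuous S -> (forall x, `|S x| <= B) ->
  is_derive y 1 (tail_resolvent b S) (b * tail_resolvent b S y - S y).
Proof.
move=> cS SB; set phi := fun t => expR (- b * t) * S t.
have cphi : continuous phi.
  move=> x; apply: (@continuousM _ _ (fun t : R => expR (- b * t)) S x).
    exact: continuous_expRM.
  exact: cS.
pose K := \int[mu]_(t in `[y - 1, +oo[) phi t.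
pose W z := expR (b * z) * (K - \int[mu]_(t in `[y - 1, z]) phi t).
have WE z : y - 1 <= z -> tail_resolvent b S z = W z.
  by move=> yz; rewrite /W Rintegral_itvB//; exact: integrable_expRNM.
have y1y : y - 1 < y by rewrite ltrBlDr ltrDl.
have dW : is_derive y 1 W (b * W y - S y).
  have dI := is_derive_Rintegral y1y cphi.
  have dK := is_deriveB (is_derive_cst K y 1) dI.
  have := is_deriveM (is_derive_expRM b y) dK.
  congr (is_derive _ _ _ _).
  (* Replacing [S y] by [e^(b y) e^(-b y) S y] makes both sides polynomials in the same atoms. *)
  rewrite /W /GRing.scale/= !fctE -[S y in RHS]mul1r -(expRM_N b y) /phi.
  by ring.
rewrite (WE y (ltW y1y)); apply: near_eq_is_derive dW => //.
by near=> z; rewrite WE// ltW//; near: z; exact: lt_nbhsr.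
Unshelve. all: by end_near. Qed.

Lemma continuous_tail_resolvent S : continuous S -> (forall x, `|S x| <= B) ->
  continuous (tail_resolvent b S).
Proof.
by move=> cS SB x; exact: (is_derive_continuous (is_derive_tail_resolvent x cS SB)).
Qed.

Lemma le_tail_resolvent S1 S2 y : continuous S1 -> (forall x, `|S1 x| <= B) ->
  continuous S2 -> (forall x, `|S2 x| <= B) -> (forall x, S1 x <= S2 x) ->
  tail_resolvent b S1 y <= tail_resolvent b S2 y.
Proof.
move=> cS1 S1B cS2 S2B S12; rewrite ler_wpM2l ?expR_ge0//.
apply: le_Rintegral => //; [exact: integrable_oc|exact: integrable_oc|].
by move=> x _; rewrite ler_wpM2l ?expR_ge0.
Qed.

Lemma tail_resolvent_ge0 S y : (forall x, 0 <= S x) -> 0 <= tail_resolvent b S y.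
Proof.
move=> S0; rewrite mulr_ge0 ?expR_ge0// Rintegral_ge0// => x _.
by rewrite mulr_ge0 ?expR_ge0.
Qed.

(** [B / b] is the stationary solution of [w' = b w - B]; it is the barrier from which
    [tail_resolvent_le] follows by monotonicity. *)
Lemma tail_resolvent_cst y : 0 <= B -> tail_resolvent b (cst B) y = B / b.
Proof.
move=> B0'; have cB : continuous (cst B : R -> R) by exact: cst_continuous.
have BB (x : R) : `|cst B x| <= B by rewrite ger0_norm.
rewrite /tail_resolvent Rintegral_itv_obnd_cbnd; last exact: integrable_oc.
rewrite RintegralZr//; last exact: integrable_expRN.
rewrite /Rintegral integral_expRN//= -[RHS]mul1r -(expRM_N b y).
by ring.
Qed.

Lemma tail_resolvent_le S y : continuous S -> (forall x, 0 <= S x <= B) ->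
  tail_resolvent b S y <= B / b.
Proof.
move=> cS SB; have B0' : 0 <= B by have /andP[] := SB 0; exact: le_trans.
rewrite -(tail_resolvent_cst y)//; apply: le_tail_resolvent => //.
- by move=> x; have /andP[? ?] := SB x; rewrite ger0_norm.
- exact: cst_continuous.
- by move=> x; rewrite ger0_norm.
- by move=> x; have /andP[] := SB x.
Qed.

Lemma cvg_tail_resolvent (S_ : nat -> R -> R) S y :
  (forall n, continuous (S_ n)) -> (forall n x, `|S_ n x| <= B) ->
  (forall x, S_ n x @[n --> \oo] --> S x) ->
  tail_resolvent b (S_ n) y @[n --> \oo] --> tail_resolvent b S y.
Proof.
move=> cS SB SS; apply: cvgMr.
apply: (@Rintegral_dominated_cvg _ _ _ _ (fun t => B * expR (- b * t))) => //.
- by move=> n; apply: measurable_funTS; exact: mS.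
- by move=> x _; apply: cvgMr; exact: SS.
- rewrite (_ : _ \o _ = fun t => (B%:E * (expR (- b * t))%:E)%E); last first.
    by apply/funext => t /=; rewrite EFinM.
  apply: integrableZl => //; apply: integrableS (integrable_expRN y b0) => //.
  by apply: subset_itvr; rewrite bnd_simp.
- move=> n x _; rewrite normrM (ger0_norm (expR_ge0 _)) mulrC.
  by rewrite ler_wpM2r ?expR_ge0.
Qed.

End tail.

(** * The forward factor, solved from the boundary value at 0 *)

Section head.
Variables (a T : R).
Hypothesis a0 : 0 < a.

Let cphi v : continuous v -> continuous (fun s : R => expR (a * s) * v s).
Proof.
move=> cv x; apply: (@continuousM _ _ (fun t : R => expR (a * t)) v x).
  exact: continuous_expRM.
exact: cv.
Qed.

Lemma head_resolvent0 v : head_resolvent a T v 0 = T.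
Proof. by rewrite /head_resolvent subrr addr0 mulr0 expR0 mul1r. Qed.

Lemma head_resolventE v y : continuous v -> 0 <= y ->
  head_resolvent a T v y =
  expR (- a * y) * (T + \int[mu]_(s in `]0, y]) (expR (a * s) * v s)).
Proof.
move=> cv y0; rewrite /head_resolvent Rintegral_itvB// ?bnd_simp ?lerN10//.
by apply: continuous_integrable_itv; exact: cphi.
Qed.

Lemma is_derive_head_resolvent v y : continuous v -> -1 < y ->
  is_derive y 1 (head_resolvent a T v) (v y - a * head_resolvent a T v y).
Proof.
move=> cv y1; pose J := \int[mu]_(s in `[-1, 0]) (expR (a * s) * v s).
have dI := is_derive_Rintegral y1 (cphi cv).
have dK := is_deriveD (is_derive_cst T y 1) (is_deriveB dI (is_derive_cst J y 1)).
have := is_deriveM (is_derive_expRM (- a) y) dK.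
congr (is_derive _ _ _ _).
rewrite /head_resolvent /GRing.scale/= !fctE -/J.
rewrite -[X in _ = X - _]mul1r -[X in _ = X * v y - _](expRM_N a y).
by ring.
Qed.

Let integrable_oc v y : continuous v ->
  mu.-integrable `]0, y] (EFin \o (fun s => expR (a * s) * v s)).
Proof.
move=> cv; apply: integrableS (continuous_integrable_itv 0 y (cphi cv)) => //.
by apply: subset_itvr; rewrite bnd_simp.
Qed.

Lemma le_head_resolvent v1 v2 y : continuous v1 -> continuous v2 ->
  (forall x, v1 x <= v2 x) -> 0 <= y ->
  head_resolvent a T v1 y <= head_resolvent a T v2 y.
Proof.
move=> cv1 cv2 v12 y0; rewrite !head_resolventE// ler_wpM2l ?expR_ge0// lerD2l.
apply: le_Rintegral => //; [exact: integrable_oc|exact: integrable_oc|].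
by move=> x _; rewrite ler_wpM2l ?expR_ge0.
Qed.

(** Dropping the nonnegative integral leaves the homogeneous solution; this is the origin of the
    strict positivity of the solutions. *)
Lemma head_resolvent_ge v y : continuous v -> (forall x, 0 <= v x) -> 0 <= y ->
  T * expR (- a * y) <= head_resolvent a T v y.
Proof.
move=> cv v0 y0; rewrite head_resolventE// mulrC ler_wpM2l ?expR_ge0// lerDl.
by apply: Rintegral_ge0 => x _; rewrite mulr_ge0 ?expR_ge0.
Qed.

(** By comparison with [v = a T], for which the constant [T] solves [u' = v - a u] with
    [u 0 = T]. *)
Lemma head_resolvent_le v y : continuous v -> (forall x, v x <= a * T) -> 0 <= y ->
  head_resolvent a T v y <= T.
Proof.
move=> cv vT y0; apply: (@le_trans _ _ (head_resolvent a T (cst (a * T)) y)).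
  by apply: le_head_resolvent => //; exact: cst_continuous.
have cT : continuous (fun s : R => expR (a * s) * (a * T)).
  by apply: cphi; exact: cst_continuous.
(* The explicit primitive [T e^(a s)] evaluates both integrals in the constant case. *)
have d (z : R) : is_derive z 1 (T \*: (fun s => expR (a * s))) (expR (a * z) * (a * T)).
  rewrite [X in is_derive _ _ _ X](_ : _ = T *: (a * expR (a * z))).
    by apply: is_deriveZ; exact: is_derive_expRM.
  by rewrite /GRing.scale/= mulrC mulrAC mulrC mulrA.
rewrite /head_resolvent (is_derive_FTC2 _ cT d); last by rewrite (le_trans _ y0)// lerN10.
rewrite (is_derive_FTC2 _ cT d) ?lerN10//= mulr0 expR0 /GRing.scale/=.
rewrite le_eqVlt; apply/orP; left; apply/eqP.
by rewrite -[RHS]mul1r -[X in _ = X * T](expRM_N a y); ring.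
Qed.

Lemma cvg_head_resolvent (v_ : nat -> R -> R) v y B : (forall n, continuous (v_ n)) ->
  continuous v -> (forall n x, `|v_ n x| <= B) ->
  (forall x, v_ n x @[n --> \oo] --> v x) -> 0 <= y ->
  head_resolvent a T (v_ n) y @[n --> \oo] --> head_resolvent a T v y.
Proof.
move=> cv_ cv vB vv y0; rewrite head_resolventE//.
under eq_fun do rewrite head_resolventE//.
apply: cvgMr; apply: cvgD; first exact: cvg_cst.
apply: (@Rintegral_dominated_cvg _ _ _ _ (fun s => expR (a * s) * B)) => //.
- by move=> n; apply: measurable_funTS; apply: continuous_measurable_fun; exact: cphi.
- by move=> x _; apply: cvgMr; exact: vv.
- by apply: integrable_oc; exact: cst_continuous.
- move=> n x _; rewrite normrM (ger0_norm (expR_ge0 _)).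
  by rewrite ler_wpM2l ?expR_ge0.
Qed.

End head.

End resolvents.

(** * The kernel [E] as an integral over cones in the plane *)

Section kernel.
Context {R : realType}.
Notation mu := (@lebesgue_measure R).
Implicit Types (A : set (R * R)) (G g q : R -> R) (x y t M d : R).

(** The density of [E], with its factor 1/2 absorbed. Extension by 0 to [t <= 0] makes it
    nonnegative and measurable on the whole line, as Tonelli on the plane requires. *)
Definition half_expN_div t : R := if 0 < t then expR (- t) / (2 * t) else 0.

Local Notation kap := half_expN_div.

Lemma half_expN_div_ge0 t : 0 <= kap t.
Proof.
by rewrite /kap; case: ifPn => // t0; rewrite divr_ge0 ?expR_ge0// mulr_ge0// ltW.
Qed.

Let continuous_expN : continuous (fun t : R => expR (- t)).
Proof.
move=> t; apply: (@continuous_comp _ _ _ -%R); first exact: opp_continuous.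
exact: continuous_expR.
Qed.

Lemma measurable_half_expN_div : measurable_fun setT kap.
Proof.
rewrite (_ : kap = (fun t => expR (- t) / (2 * t)) \_ `]0, +oo[); last first.
  by apply/funext => t; rewrite patchE mem_setE in_itv/= andbT.
apply/(measurable_restrictT _ _).1 => //.
apply: open_continuous_measurable_fun => //.
move=> t; rewrite inE/= in_itv/= andbT => t0.
apply: cvgM; first exact: continuous_expN.
by apply: cvgV; [rewrite mulf_neq0 ?gt_eqF|apply: cvgMr; exact: cvg_id].
Qed.

Lemma EkernelE x :
  Ekernel x = (\int[mu]_t (\1_`]`|x|, +oo[ t * kap t)%:E)%E.
Proof.
rewrite /Ekernel -ge0_integralZl//; last 2 first.
- apply/measurable_EFinP; apply: open_continuous_measurable_fun => //.
  move=> t; rewrite inE/= in_itv/= andbT => xt.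
  apply: cvgM; first exact: continuous_expN.
  by apply: cvgV; [rewrite gt_eqF// (le_lt_trans _ xt)|exact: cvg_id].
- move=> t /=; rewrite in_itv/= andbT => xt; rewrite lee_fin.
  by rewrite divr_ge0 ?expR_ge0// (le_trans _ (ltW xt)).
rewrite integral_mkcond; apply: eq_integral => t _.
rewrite patchE indicE; case: ifPn => [|_]; last by rewrite mul0r.
rewrite inE/= in_itv/= andbT mul1r => xt.
have t0 : 0 < t by exact: le_lt_trans xt.
by rewrite /kap t0 -EFinM invfM mulrCA.
Qed.

(** The region [A] is left arbitrary because the Hoelder estimate also integrates over the
    difference of two cones. *)
Definition cone_integral A G : \bar R :=
  (\int[mu \x mu]_p (\1_A p * (kap p.2 * G p.1))%:E)%E.

Definition cone y : set (R * R) := [set p | 0 <= p.1 /\ `|y - p.1| < p.2].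

Lemma measurable_cone y : measurable (cone y).
Proof.
rewrite (_ : cone y = (fst @^-1` `[0, +oo[) `&`
  ((fun p => p.2 - `|y - p.1|) @^-1` `]0, +oo[)); last first.
  apply/seteqP; split => p /=; rewrite !in_itv/= !andbT subr_gt0; first by move=> [].
  by move=> [].
apply: measurableI.
  by rewrite -[X in measurable X]setTI; exact: measurable_fst.
rewrite -[X in measurable X]setTI.
suff : measurable_fun setT (fun p : R * R => p.2 - `|y - p.1|) by exact.
apply: measurable_funB; first exact: measurable_snd.
apply: measurableT_comp => //; apply: measurable_funB => //.
Qed.

Let measurable_integrand A G : measurable A -> measurable_fun setT G ->
  measurable_fun setT (fun p : R * R => (\1_A p * (kap p.2 * G p.1))%:E).
Proof.
move=> mA mG; apply/measurable_EFinP; apply: measurable_funM => //.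
apply: measurable_funM.
  by apply: measurableT_comp => //; exact: measurable_half_expN_div.
by apply: measurableT_comp.
Qed.

Let integrand_ge0 A G p : (forall x, 0 <= G x) ->
  (0 <= (\1_A p * (kap p.2 * G p.1))%:E)%E.
Proof. by move=> G0; rewrite lee_fin !mulr_ge0// half_expN_div_ge0. Qed.

Lemma cone_integral_ge0 A G : (forall x, 0 <= G x) -> (0 <= cone_integral A G)%E.
Proof. by move=> G0; apply: integral_ge0 => p _; exact: integrand_ge0. Qed.

(** Tonelli, integrating in [t] first: over a point [x >= 0] the cone is the half-line
    [t > |y - x|], on which the density integrates to [Ekernel (y - x)]; over [x < 0] it is
    empty. *)
Lemma Eint_cone g y : measurable_fun setT g ->
  Eint g y = cone_integral (cone y) (fun x => g x ^+ 4).
Proof.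
move=> mg.
have mG : measurable_fun setT (fun x => g x ^+ 4) by exact: measurable_funX.
have G0 x : 0 <= g x ^+ 4 by rewrite exprn_even_ge0.
rewrite /cone_integral fubini_tonelli1; last 2 first.
- exact: (measurable_integrand (measurable_cone y) mG).
- by move=> p; exact: (integrand_ge0 _ _ G0).
rewrite /Eint integral_mkcond; apply: eq_integral => x _; rewrite patchE /fubini_F.
case: ifPn => [|/negP]; rewrite inE/= in_itv/= andbT => x0; last first.
  rewrite integral0_eq// => t _; rewrite indicE memNset ?mul0r// => -[] /=.
  by move=> x0' _; apply: x0.
have mk : measurable_fun setT
    (fun t => (\1_`]`|y - x|, +oo[ t * kap t)%:E : \bar R).
  apply/measurable_EFinP; apply: measurable_funM; first exact: measurable_indic.
  exact: measurable_half_expN_div.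
have k0 (t : R) : [set: R] t -> (0 <= (\1_`]`|y - x|, +oo[ t * kap t)%:E)%E.
  by move=> _; rewrite lee_fin mulr_ge0// half_expN_div_ge0.
rewrite EkernelE -(ge0_integralZr mu measurableT mk k0); last by rewrite lee_fin.
apply: eq_integral => t _; rewrite -EFinM -mulrA; congr (_ * _)%:E.
rewrite !indicE; congr ((nat_of_bool _)%:R).
by apply/idP/idP; rewrite !inE/= in_itv/= andbT => // -[].
Qed.

Lemma le_cone_integral A G1 G2 : measurable A ->
  measurable_fun setT G1 -> measurable_fun setT G2 ->
  (forall x, 0 <= G1 x <= G2 x) -> (cone_integral A G1 <= cone_integral A G2)%E.
Proof.
move=> mA mG1 mG2 G12; apply: ge0_le_integral => //.
- by move=> p _; apply: integrand_ge0 => x; have /andP[] := G12 x.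
- exact: measurable_integrand.
- exact: measurable_integrand.
- move=> p _; rewrite lee_fin !ler_wpM2l// ?half_expN_div_ge0//.
  by have /andP[] := G12 p.1.
Qed.

(** Tonelli in the other order: at height [t] the inner integral is at most [M] times the density
    times the length of the slice of [A]. Both later estimates thereby reduce to measuring
    slices. *)
Lemma cone_integral_le A G M q : measurable A -> measurable_fun setT G ->
  (forall x, 0 <= G x <= M) -> measurable_fun (`[0, +oo[ : set R) q ->
  (forall t, 0 <= t -> 0 <= q t) ->
  (forall t, 0 < t -> ((kap t * M)%:E * mu (ysection A t) <= (q t)%:E)%E) ->
  (cone_integral A G <= \int[mu]_(t in `[0%R, +oo[) (q t)%:E)%E.
Proof.
move=> mA mG GM mq q0 Aq.
have G0 x : 0 <= G x by have /andP[] := GM x.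
have M0 : 0 <= M by rewrite (le_trans (G0 0))//; have /andP[] := GM 0.
have mF := measurable_integrand mA mG.
rewrite /cone_integral fubini_tonelli2//; last by move=> p; exact: integrand_ge0.
rewrite [leRHS]integral_mkcond; apply: ge0_le_integral => //.
- by move=> t _; apply: integral_ge0 => x _; exact: integrand_ge0.
- by apply: measurable_fun_fubini_tonelli_G => // p; exact: integrand_ge0.
- apply/(measurable_restrictT _ _).1 => //.
  exact/measurable_EFinP.
move=> t _; rewrite /fubini_G patchE.
have [t0|t0] := ltP 0 t; last first.
  rewrite integral0_eq; last by move=> x _; rewrite /= /kap ltNge t0 mul0r mulr0.
  by case: ifPn => //; rewrite inE/= in_itv/= andbT => t0'; rewrite lee_fin q0.
rewrite ifT; last by rewrite inE/= in_itv/= andbT ltW.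
apply: le_trans (Aq _ t0).
have mAt : measurable (ysection A t) by exact: measurable_ysection.
apply: (@le_trans _ _ (\int[mu]_x ((kap t * M)%:E * (\1_(ysection A t) x)%:E))%E).
  apply: ge0_le_integral => //.
  - by move=> x _; exact: integrand_ge0.
  - apply/measurable_EFinP; apply: measurable_funM.
      rewrite (_ : (fun x => \1_A (x, t)) = \1_(ysection A t)); last first.
        by apply/funext => x; rewrite !indicE mem_ysection.
      exact: measurable_indic.
    by apply: (@measurable_funM _ _ _ _ (cst (kap t)) G).
  - apply/measurable_EFinP; apply: measurable_funM; first exact: measurable_cst.
    exact: measurable_indic.
  - move=> x _; rewrite -EFinM lee_fin !indicE mem_ysection mulrC /=.
    rewrite ler_wpM2r// ler_wpM2l ?half_expN_div_ge0//.
    by have /andP[] := GM x.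
rewrite ge0_integralZl//.
- by rewrite integral_indic// setIT.
- by apply/measurable_EFinP; exact: measurable_indic.
- by rewrite lee_fin mulr_ge0// half_expN_div_ge0.
Qed.

Let half_expN_divE t : 0 < t -> kap t * t = expR (- t) / 2.
Proof.
by move=> t0; rewrite /kap t0 invfM mulrA mulfVK ?gt_eqF.
Qed.

(** The slice at height [t] lies in the ball of radius [t] around [y], of length [2 t]. Times the
    density this gives [e^(-t)], whose integral is 1: the kernel has mass at most 1 on the
    half-line. *)
Lemma cone_integral_bounded y G M : measurable_fun setT G ->
  (forall x, 0 <= G x <= M) -> (cone_integral (cone y) G <= M%:E)%E.
Proof.
move=> mG GM.
have M0 : 0 <= M by have /andP[] := GM 0; exact: le_trans.
have := @cone_integral_le (cone y) G M (fun t => M * expR (- 1 * t))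
  (measurable_cone y) mG GM.
have -> : (\int[mu]_(t in `[0%R, +oo[) (M * expR (- 1 * t))%:E = M%:E)%E.
  under eq_integral do rewrite EFinM.
  rewrite ge0_integralZl//.
  - by rewrite integral_expRN// mulr0 expR0 divr1 mule1.
  - apply/measurable_EFinP; apply: measurable_funTS.
    by apply: continuous_measurable_fun; exact: continuous_expRM.
apply.
- apply: measurable_funTS; apply: measurable_funM => //.
  by apply: continuous_measurable_fun; exact: continuous_expRM.
- by move=> t _; rewrite mulr_ge0 ?expR_ge0.
move=> t t0.
have At : ysection (cone y) t `<=` ball y t.
  by move=> x /=; rewrite ysectionE/= => -[].
have mAt : (mu (ysection (cone y) t) <= (t *+ 2)%:E)%E.
  rewrite -(lebesgue_measure_ball y (ltW t0)) le_measure ?inE//.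
  - by apply: measurable_ysection; exact: measurable_cone.
  - exact: measurable_ball.
apply: (le_trans (lee_wpmul2l _ mAt)).
  by rewrite lee_fin mulr_ge0// half_expN_div_ge0.
rewrite -EFinM lee_fin mulN1r mulrAC -mulr_natr mulrA half_expN_divE//.
by rewrite mulfVK// mulrC.
Qed.

Lemma cone_integral_setU A A1 A2 G : measurable A -> measurable A1 -> measurable A2 ->
  measurable_fun setT G -> (forall x, 0 <= G x) -> A `<=` A1 `|` A2 ->
  (cone_integral A G <= cone_integral A1 G + cone_integral A2 G)%E.
Proof.
move=> mA mA1 mA2 mG G0 AA; rewrite /cone_integral -ge0_integralD//; last 4 first.
- by move=> p _; exact: integrand_ge0.
- exact: measurable_integrand.
- by move=> p _; exact: integrand_ge0.
- exact: measurable_integrand.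
apply: ge0_le_integral => //.
- by move=> p _; exact: integrand_ge0.
- exact: measurable_integrand.
- by apply: emeasurable_funD; exact: measurable_integrand.
move=> p _; rewrite -EFinD lee_fin -mulrDl ler_wpM2r ?mulr_ge0 ?half_expN_div_ge0//.
rewrite !indicE; have [/set_mem/AA[]|] := boolP (p \in A); last by rewrite addr_ge0.
  by move=> /mem_set ->; rewrite lerDl.
by move=> /mem_set ->; rewrite lerDr.
Qed.

Let continuous_sqrtD d t : {for t, continuous (fun t => Num.sqrt (t + d))}.
Proof.
apply: (@continuous_comp _ _ _ (fun t => t + d)); last exact: sqrt_continuous.
by apply: cvgD; [exact: cvg_id|exact: cvg_cst].
Qed.

Let continuous_expr32 M d t : 0 < t + d ->
  {for t, continuous (fun t => M * (d / ((t + d) * Num.sqrt (t + d))))}.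
Proof.
move=> td; apply: cvgMr; apply: cvgMr; apply: cvgV.
  by rewrite mulf_neq0// gt_eqF// sqrtr_gt0.
apply: cvgM; last exact: continuous_sqrtD.
by apply: cvgD; [exact: cvg_id|exact: cvg_cst].
Qed.

(** The primitive is [-2 M d (t + d)^(-1/2)]. The integrand is the majorant of the Hoelder estimate
    below; its integral scales like [sqrt d]. *)
Lemma integral_expr32 d M : 0 < d -> 0 <= M ->
  (\int[mu]_(t in `[0%R, +oo[)
     (M * (d / ((t + d) * Num.sqrt (t + d))))%:E = (M * (2 * Num.sqrt d))%:E)%E.
Proof.
move=> d0 M0; pose F t := - (2 * M * d) * (Num.sqrt (t + d))^-1.
rewrite (_ : (M * _)%:E = 0%:E - (F 0)%:E)%E; last first.
  rewrite sub0e -EFinN /F add0r mulNr opprK; congr EFin.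
  rewrite -{2}(sqr_sqrtr (ltW d0)) expr2 !mulrA mulfK ?gt_eqF ?sqrtr_gt0//; ring.
apply: ge0_is_derive_FTC2y.
- move=> t t0; rewrite mulr_ge0// divr_ge0 ?mulr_ge0 ?sqrtr_ge0 ?addr_ge0// ltW//.
- by move=> t t0; apply: continuous_expr32; rewrite ltr_wpDl.
- move=> t t0.
  have td : 0 < t + d by rewrite ltr_wpDl.
  have dD : is_derive t 1 (fun t => t + d) 1.
    rewrite -[X in is_derive _ _ _ X]addr0.
    exact: (is_deriveD (is_derive_id t 1) (is_derive_cst d t 1)).
  have dS := @is_derive1_comp _ Num.sqrt (fun t => t + d) t _ _
    (is_derive1_sqrt td) dD.
  have s0 : Num.sqrt (t + d) != 0 by rewrite gt_eqF// sqrtr_gt0.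
  have := is_deriveZ (- (2 * M * d))
    (@is_deriveV _ (Num.sqrt \o (fun t => t + d)) t _ _ s0 dS).
  congr (is_derive _ _ _ _).
  rewrite /GRing.scale/=; move: s0 (sqr_sqrtr (ltW td)).
  by move: (Num.sqrt (t + d)) => s s0 <-; field.
- rewrite -(mulr0 (- (2 * M * d))); apply: cvgMr.
  apply/gtr0_cvgV0.
    near=> t; rewrite sqrtr_gt0 ltr_wpDl//; near: t; exact: nbhs_pinfty_ge.
  apply/cvgryPge => A; near=> t; rewrite (le_trans (ler_norm A))// -sqrtr_sqr.
  rewrite ler_wsqrtr// (@le_trans _ _ t)// ?lerDl ?(ltW d0)//.
Unshelve. all: by end_near. Qed.

(** Only the part of the cone at [y] outside the cone at [z] contributes to the excess. Its slice at
    height [t] has length at most [min (2 t) d], which tames the [1 / t] singularity of the density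
    and leaves a majorant [2 M d (t + d)^(-3/2)]. *)
Lemma cone_integral_holder y z G M : measurable_fun setT G ->
  (forall x, 0 <= G x <= M) -> `|y - z| <= 1 ->
  (cone_integral (cone y) G <=
   cone_integral (cone z) G + (4 * M * Num.sqrt `|y - z|)%:E)%E.
Proof.
move=> mG GM; set d := `|y - z| => d1.
have G0 x : 0 <= G x by have /andP[] := GM x.
have M0 : 0 <= M by have /andP[] := GM 0; exact: le_trans.
have [d0|] := ltP 0 d; last first.
  rewrite normr_le0 subr_eq0 /d => /eqP ->.
  by rewrite subrr normr0 sqrtr0 mulr0 adde0.
have mD : measurable (cone y `\` cone z) by apply: measurableD; exact: measurable_cone.
apply: le_trans (@cone_integral_setU _ (cone z) (cone y `\` cone z) G _ _ _ _ _ _) _.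
all: rewrite ?setDE//; try exact: measurable_cone.
  by move=> p yp; have [zp|zp] := pselect (cone z p); [left|right].
rewrite leeD2l//.
rewrite (_ : 4 * M * Num.sqrt d = (2 * M) * (2 * Num.sqrt d)); last by ring.
rewrite -integral_expr32 ?mulr_ge0//; apply: cone_integral_le mG GM _ _ _ => //.
(* The majorant is continuous on the larger open half-line, hence measurable there and on [[0,
   +oo[]. *)
- apply: (@measurable_funS _ _ _ _ `]- d, +oo[) => //.
    by apply: subset_itvr; rewrite bnd_simp oppr_lt0.
  apply: open_continuous_measurable_fun => // t.
  rewrite inE/= in_itv/= andbT -subr_gt0 opprK => td0.
  exact: continuous_expr32.
- move=> t t0; rewrite !mulr_ge0// ?invr_ge0 ?mulr_ge0 ?sqrtr_ge0 ?addr_ge0// ltW//.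
move=> t t0; set s := Num.sqrt (t + d).
have td0 : 0 < t + d by rewrite addr_gt0.
have s0 : 0 < s by rewrite sqrtr_gt0.
set D := ysection _ t.
have mDt : measurable D by exact: measurable_ysection.
have D2t : (mu D <= (t *+ 2)%:E)%E.
  rewrite -(lebesgue_measure_ball y (ltW t0)) le_measure ?inE//.
    exact: measurable_ball.
  by move=> x /=; rewrite /D ysectionE/= => -[[]].
(* A point within [t] of [y] but not of [z] lies at the end of the ball around [y] that faces away
   from [z], in an interval of length [d]. *)
have Dd : (mu D <= d%:E)%E.
  have Dx x : D x -> (- t < y - x < t) /\ ~ (- t < z - x < t).
    rewrite /D ysectionE/= => -[[x0]]; rewrite ltr_norml => yx zx; split=> // zx'.
    by apply: zx; split=> //=; rewrite ltr_norml.
  have [yz|zy] := leP y z.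
    apply: (@le_trans _ _ (mu `]y - t, z - t])).
      rewrite le_measure ?inE// => x /Dx[/andP[yx1 yx2] zx] /=.
      rewrite in_itv/=; apply/andP; split; first by lra.
      by rewrite leNgt; apply/negP => xz; apply: zx; apply/andP; split; lra.
    rewrite lebesgue_measure_itv/= lte_fin /d distrC ger0_norm ?subr_ge0//.
    by case: ifP => _; rewrite -?EFinD lee_fin ?subr_ge0//; lra.
  apply: (@le_trans _ _ (mu `[z + t, y + t[)).
    rewrite le_measure ?inE// => x /Dx[/andP[yx1 yx2] zx] /=.
    rewrite in_itv/=; apply/andP; split; last by lra.
    by rewrite leNgt; apply/negP => xz; apply: zx; apply/andP; split; lra.
  rewrite lebesgue_measure_itv/= lte_fin ltrD2r zy -EFinB lee_fin.
  by rewrite /d gtr0_norm ?subr_gt0//; lra.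
pose m := Num.min (t *+ 2) d.
have Dm : (mu D <= m%:E)%E by rewrite /m EFin_min lexI D2t Dd.
have k0 := half_expN_div_ge0 t.
apply: (le_trans (lee_wpmul2l _ Dm)); first by rewrite lee_fin mulr_ge0.
rewrite -EFinM lee_fin.
(* Here [d <= 1] enters: [s^2 = t + d <= 1 + t <= e^t <= e^(2 t)]. *)
have sE : s * expR (- t) <= 1.
  rewrite expRN -ler_pdivlMr ?mul1r ?invr_gt0 ?expR_gt0// invrK.
  have et : 1 <= expR t by rewrite (le_trans _ (expR_ge1Dx t))// lerDl ltW.
  rewrite -(ger0_norm (expR_ge0 t)) -sqrtr_sqr ler_sqrt ?exprn_even_ge0//.
  rewrite (@le_trans _ _ (expR t))//; last by rewrite expr2 ler_peMl ?expR_ge0.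
  by rewrite (le_trans _ (expR_ge1Dx t))// addrC lerD2r.
have m0 : 0 <= m by rewrite /m le_min mulrn_wge0 ?ltW.
(* Use [m <= d] against the factor [t] and [m <= 2 t] against the factor [d]. *)
have mtd : m * (t + d) <= 3 * (t * d).
  have m1 : m <= t *+ 2 by rewrite ge_min lexx.
  have m2 : m <= d by rewrite ge_min lexx orbT.
  by rewrite mulr2n in m1; nra.
rewrite mulrA ler_pdivlMr ?mulr_gt0//.
rewrite [leLHS](_ : _ = (kap t * (m * (t + d))) * (M * s)); last by ring.
apply: (@le_trans _ _ (kap t * (3 * (t * d)) * (M * s))).
  by rewrite ler_wpM2r ?mulr_ge0 ?(ltW s0)// ler_wpM2l.
rewrite [leLHS](_ : _ = kap t * t * 3 * d * M * s); last by ring.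
rewrite half_expN_divE//.
rewrite [leLHS](_ : _ = (s * expR (- t)) * (3 / 2 * d * M)); last by field.
have dM : 0 <= d * M by rewrite mulr_ge0// ltW.
apply: (@le_trans _ _ (1 * (3 / 2 * d * M))).
  by rewrite ler_wpM2r// -mulrA mulr_ge0//; lra.
nra.
Qed.

(** Dominated convergence on the plane; the dominating integrand is that of the constant [M],
    integrable by [cone_integral_bounded]. *)
Lemma cvg_cone_integral y (G_ : nat -> R -> R) G M :
  (forall n, measurable_fun setT (G_ n)) -> (forall n x, 0 <= G_ n x <= M) ->
  (forall x, G_ n x @[n --> \oo] --> G x) ->
  cone_integral (cone y) (G_ n) @[n --> \oo] --> cone_integral (cone y) G.
Proof.
move=> mG GM GG; have M0 : 0 <= M by have /andP[] := GM 0%N 0; exact: le_trans.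
have mI := measurable_integrand (measurable_cone y).
apply: (@dominated_cvg _ _ _ (mu \x mu)%E setT measurableT
  (fun n p => (\1_(cone y) p * (kap p.2 * G_ n p.1))%:E) _
  (fun p => (\1_(cone y) p * (kap p.2 * cst M p.1))%:E)) => //.
- by move=> n; exact: mI.
- move=> p _; apply: cvg_EFin; first exact: nearW.
  by apply: cvgMr; apply: cvgMr; exact: GG.
- apply/integrableP; split; first exact: (mI (cst M)).
  under eq_integral do rewrite gee0_abs ?integrand_ge0//.
  apply: (@le_lt_trans _ _ M%:E); last exact: ltry.
  by apply: cone_integral_bounded => // x; rewrite M0 /=.
- move=> n p _; rewrite gee0_abs ?lee_fin; last first.
    by apply: integrand_ge0 => x; have /andP[] := GM n x.
  rewrite !ler_wpM2l ?half_expN_div_ge0//.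
  by have /andP[] := GM n p.1.
Qed.

End kernel.

(** * The nonlocal term as a real-valued function: bounds, monotonicity, Hoelder continuity,
    limits *)

Section radiation.
Context {R : realType}.
Implicit Types (g : R -> R) (y z T : R).

(** [fine] would send an infinite integral to 0; [EintE] excludes this for continuous [g] with
    values in [[0, T]]. *)
Definition radiation g y : R := fine (Eint g y).

Section bounded_source.
Variable T : R.

Let pow4 g : (forall x, 0 <= g x <= T) -> forall x, 0 <= g x ^+ 4 <= T ^+ 4.
Proof.
move=> gT x; have /andP[g0 g1] := gT x.
by rewrite exprn_ge0//= lerXn2r// nnegrE (le_trans g0).
Qed.

Let mpow4 g : continuous g -> measurable_fun setT (fun x => g x ^+ 4).
Proof. by move=> cg; apply: measurable_funX; exact: continuous_measurable_fun. Qed.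

Lemma EintE g y : continuous g -> (forall x, 0 <= g x <= T) ->
  Eint g y = (radiation g y)%:E.
Proof.
move=> cg gT; rewrite /radiation fineK//.
rewrite Eint_cone; last exact: continuous_measurable_fun.
rewrite ge0_fin_numE; last first.
  by apply: cone_integral_ge0 => x; have /andP[] := pow4 gT x.
apply: (@le_lt_trans _ _ (T ^+ 4)%:E); last exact: ltry.
by apply: cone_integral_bounded; [exact: mpow4|exact: pow4].
Qed.

Let radiation_cone g y : continuous g -> (forall x, 0 <= g x <= T) ->
  (radiation g y)%:E = cone_integral (cone y) (fun x => g x ^+ 4).
Proof.
move=> cg gT; rewrite -EintE// Eint_cone//; exact: continuous_measurable_fun.
Qed.

Lemma radiation_bounds g y : continuous g -> (forall x, 0 <= g x <= T) ->
  0 <= radiation g y <= T ^+ 4.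
Proof.
move=> cg gT; rewrite -!lee_fin radiation_cone//; apply/andP; split.
  by apply: cone_integral_ge0 => x; have /andP[] := pow4 gT x.
by apply: cone_integral_bounded; [exact: mpow4|exact: pow4].
Qed.

Lemma le_radiation g1 g2 y : continuous g1 -> (forall x, 0 <= g1 x <= T) ->
  continuous g2 -> (forall x, 0 <= g2 x <= T) -> (forall x, g1 x <= g2 x) ->
  radiation g1 y <= radiation g2 y.
Proof.
move=> cg1 g1T cg2 g2T g12.
rewrite -lee_fin (radiation_cone y cg1 g1T) (radiation_cone y cg2 g2T).
apply: le_cone_integral; [exact: measurable_cone|exact: mpow4|exact: mpow4|].
move=> x; have /andP[g10 _] := g1T x; have /andP[g20 _] := g2T x.
by rewrite exprn_ge0//= lerXn2r.
Qed.

(** At distance at most 1, apply the one-sided cone estimate in both directions. Beyond distance 1,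
    both values lie in [[0, T^4]] and the square root exceeds 1. *)
Lemma radiation_holder g y z : continuous g -> (forall x, 0 <= g x <= T) ->
  `|radiation g y - radiation g z| <= 4 * T ^+ 4 * Num.sqrt `|y - z|.
Proof.
move=> cg gT.
have T0 : 0 <= T ^+ 4 by rewrite exprn_even_ge0.
have [yz|yz] := leP `|y - z| 1.
  have h x w : `|x - w| <= 1 ->
      radiation g x <= radiation g w + 4 * T ^+ 4 * Num.sqrt `|x - w|.
    move=> xw.
    have := @cone_integral_holder _ x w _ _ (mpow4 cg) (pow4 gT) xw.
    by rewrite -(radiation_cone x cg gT) -(radiation_cone w cg gT) -EFinD lee_fin.
  have h1 := h _ _ yz; have h2 := h z y; rewrite distrC in h2.
  by rewrite ler_norml lerBlDl h1 andbT lerNl opprB lerBlDl h2.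
have s1 : 1 <= Num.sqrt `|y - z| by rewrite -[leLHS]sqrtr1 ler_wsqrtr// ltW.
move: (radiation_bounds y cg gT) (radiation_bounds z cg gT) T0 s1.
move: (radiation g y) (radiation g z) (T ^+ 4) (Num.sqrt _) => u v B s.
move=> /andP[u0 uB] /andP[v0 vB] B0 s1.
apply: (@le_trans _ _ B); first by rewrite ler_norml; apply/andP; split; lra.
by nra.
Qed.

Lemma cvg_radiation (g_ : nat -> R -> R) g y :
  (forall n, continuous (g_ n)) -> (forall n x, 0 <= g_ n x <= T) ->
  continuous g -> (forall x, g_ n x @[n --> \oo] --> g x) ->
  radiation (g_ n) y @[n --> \oo] --> radiation g y.
Proof.
move=> cg_ g_T cg gg.
have gT x : 0 <= g x <= T.
  apply/andP; split.
    apply: (@cvgr_to_ge _ \oo _ _ (fun n => g_ n x)); first exact: gg.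
    by apply: nearW => n; have /andP[] := g_T n x.
  apply: (@cvgr_to_le _ \oo _ _ (fun n => g_ n x)); first exact: gg.
  by apply: nearW => n; have /andP[] := g_T n x.
apply: fine_cvg; rewrite -EintE// Eint_cone; last exact: continuous_measurable_fun.
rewrite (_ : (fun n => Eint (g_ n) y) =
    (fun n => cone_integral (cone y) (fun x => g_ n x ^+ 4))); last first.
  by apply/funext => n; rewrite Eint_cone//; exact: continuous_measurable_fun.
apply: (@cvg_cone_integral _ _ _ _ (T ^+ 4)).
- by move=> n; exact: mpow4.
- by move=> n; exact: pow4.
- move=> x; apply: (@cvg_comp _ _ _ (fun n => g_ n x) (fun t => t ^+ 4)).
    exact: gg.
  exact: exprn_continuous.
Qed.

End bounded_source.

End radiation.

(** * Continuity from a Hoelder or Lipschitz bound *)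

Section continuity.
Context {R : realType}.

Lemma sqrt_holder_continuous (f : R -> R) (C : R) :
  (forall x y, `|f x - f y| <= C * Num.sqrt `|x - y|) -> continuous f.
Proof.
move=> fC x; have C0 : 0 <= C.
  by have := fC 1 0; rewrite subr0 normr1 sqrtr1 mulr1; exact: le_trans.
apply/cvgrPdist_le => e e0.
(* Dividing by [C + 1] rather than [C] covers the case [C = 0]. *)
have eC0 : 0 < e / (C + 1) by rewrite divr_gt0// ltr_wpDl.
have /(cvgr_dist_lt (V := R)) : y @[y --> x] --> x by exact: cvg_id.
have e2 : 0 < (e / (C + 1)) ^+ 2 by rewrite exprn_gt0.
move=> /(_ _ e2); apply: filterS => y /ltW /ler_wsqrtr.
rewrite sqrtr_sqr (ger0_norm (ltW eC0)) ler_pdivlMr ?ltr_wpDl// => h.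
by apply: (le_trans (fC _ _)); have := sqrtr_ge0 `|x - y|; nra.
Qed.

Lemma lipschitz_continuous (f : R -> R) (L : R) :
  (forall x y, `|f x - f y| <= L * `|x - y|) -> continuous f.
Proof.
move=> fL x; have L0 : 0 <= L.
  by have := fL 1 0; rewrite subr0 normr1 mulr1; exact: le_trans.
apply/cvgrPdist_le => e e0.
have eL0 : 0 < e / (L + 1) by rewrite divr_gt0// ltr_wpDl.
have /(cvgr_dist_lt (V := R)) : y @[y --> x] --> x by exact: cvg_id.
move=> /(_ _ eL0); apply: filterS => y.
rewrite ltr_pdivlMr ?ltr_wpDl// => h; apply: (le_trans (fL _ _)).
by have := normr_ge0 (x - y); nra.
Qed.

End continuity.

(** * The monotone map [step] on the class of admissible functions *)

Section nonlinear.
Context {R : realType}.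
Variables a b T : R.
Hypotheses (T0 : 0 < T) (a0 : 0 < a) (ab : a <= b) (abT : 4 * T ^+ 3 <= a * b).
Implicit Types (u g : R -> R) (x y : R).

Let b0 : 0 < b. Proof. exact: lt_le_trans ab. Qed.

(** Both conditions are closed under pointwise limits, so limits of admissible functions are again
    continuous. The Lipschitz constant [a * T] is the bound on the derivative in [profile1_norm],
    which lets [step] preserve the class. *)
Definition admissible u := (forall x, 0 <= u x <= T) /\
  (forall x y, `|u x - u y| <= a * T * `|x - y|).

Definition source u g x := a * b * u x - u x ^+ 4 + radiation g x.

Definition flux u g := tail_resolvent b (source u g).

Definition profile u g := head_resolvent a T (flux u g).

(** For negative [y] the profile is frozen at its boundary value [T], so that the bounds hold on the
    whole line; the equation and the integral see only [y >= 0]. *)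
Definition step u g y := profile u g (Num.max y 0).

(** The difference quotient of the fourth power is a sum of four cubic monomials, each at most
    [T^3]; the choice [a b >= 4 T^3] is made for this. It says that [s |-> a b s - s^4] is
    nondecreasing on [[0, T]]. *)
Lemma pow4_slope (r s : R) : 0 <= r -> r <= s -> s <= T ->
  s ^+ 4 - r ^+ 4 <= a * b * (s - r).
Proof.
move=> r0 rs sT.
have -> : s ^+ 4 - r ^+ 4 = (s ^+ 3 + s ^+ 2 * r + s * r ^+ 2 + r ^+ 3) * (s - r) by ring.
rewrite ler_wpM2r ?subr_ge0// (le_trans _ abT)//.
have s0 : 0 <= s by exact: le_trans rs.
have rT := le_trans rs sT.
have h3 (p q w : R) : 0 <= p -> p <= T -> 0 <= q -> q <= T -> 0 <= w -> w <= T ->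
    p * q * w <= T ^+ 3.
  move=> p0 pT q0 qT w0 wT; rewrite [leRHS](_ : _ = T * T * T); last by ring.
  by apply: ler_pM => //; [exact: mulr_ge0|exact: ler_pM].
rewrite [leLHS](_ : _ = s * s * s + s * s * r + s * r * r + r * r * r); last by ring.
rewrite [leRHS](_ : _ = T ^+ 3 + T ^+ 3 + T ^+ 3 + T ^+ 3); last by ring.
by rewrite !lerD// h3.
Qed.

Lemma pow4_lipschitz (r s : R) : 0 <= r <= T -> 0 <= s <= T ->
  `|s ^+ 4 - r ^+ 4| <= a * b * `|s - r|.
Proof.
wlog rs : r s / r <= s => [h|/andP[r0 rT] /andP[s0 sT]].
  by have [/h//|/ltW/h] := leP r s; rewrite distrC (distrC s) => h' ? ?; exact: h'.
rewrite !ger0_norm ?subr_ge0 ?lerXn2r//; exact: pow4_slope.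
Qed.

Lemma admissible_continuous u : admissible u -> continuous u.
Proof. by move=> [_]; exact: lipschitz_continuous. Qed.

Lemma admissible0 : admissible (cst 0).
Proof.
split=> [x|x y] /=; first by rewrite lexx ltW.
by rewrite subrr normr0 !mulr_ge0// ltW.
Qed.

Lemma cvg_admissible (u_ : nat -> R -> R) u : (forall n, admissible (u_ n)) ->
  (forall x, u_ n x @[n --> \oo] --> u x) -> admissible u.
Proof.
move=> au uu; split=> [x|x y].
  apply/andP; split.
    apply: (@cvgr_to_ge _ \oo _ _ (fun n => u_ n x)); first exact: uu.
    by apply: nearW => n; have [/(_ x)/andP[]] := au n.
  apply: (@cvgr_to_le _ \oo _ _ (fun n => u_ n x)); first exact: uu.
  by apply: nearW => n; have [/(_ x)/andP[]] := au n.
apply: (@cvgr_to_le _ \oo _ _ (fun n => `|u_ n x - u_ n y|)).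
  by apply: cvg_norm; apply: cvgB; exact: uu.
by apply: nearW => n; have [_] := au n; exact.
Qed.

Let radiation_continuous g : admissible g -> continuous (radiation g).
Proof.
move=> ag; have [gT _] := ag.
apply: (@sqrt_holder_continuous _ _ (4 * T ^+ 4)) => x y.
by apply: radiation_holder => //; exact: admissible_continuous.
Qed.

Lemma source_continuous u g : admissible u -> admissible g ->
  continuous (source u g).
Proof.
move=> au ag x; have cu := admissible_continuous au.
apply: cvgD; last exact: radiation_continuous.
apply: cvgB; first by apply: cvgMr; exact: cu.
by apply: (@cvg_comp _ _ _ u (fun t => t ^+ 4)); [exact: cu|exact: exprn_continuous].
Qed.

(** Monotonicity of [a b s - s^4] between 0 and [u x] gives the lower bound. Between [u x] and [T]
    it gives at most [a b T - T^4], and the radiation term adds at most [T^4]: the constant [T] is a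
    supersolution. *)
Lemma source_bounds u g x : admissible u -> admissible g ->
  0 <= source u g x <= a * b * T.
Proof.
move=> [uT _] ag; have [gT _] := ag.
have /andP[ux0 uxT] := uT x.
have := radiation_bounds x (admissible_continuous ag) gT.
have := pow4_slope (lexx 0) ux0 uxT; have := pow4_slope ux0 uxT (lexx T).
rewrite /source; move: (radiation g x) (u x) => h s.
by rewrite expr0n/= => h1 h2 /andP[h3 h4]; apply/andP; split; lra.
Qed.

Let source_norm u g x : admissible u -> admissible g ->
  `|source u g x| <= a * b * T.
Proof.
by move=> au ag; have /andP[? ?] := source_bounds x au ag; rewrite ger0_norm.
Qed.

Lemma le_source u1 u2 g1 g2 x : admissible u1 -> admissible u2 ->
  admissible g1 -> admissible g2 ->
  (forall y, u1 y <= u2 y) -> (forall y, g1 y <= g2 y) ->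
  source u1 g1 x <= source u2 g2 x.
Proof.
move=> au1 au2 ag1 ag2 u12 g12.
have /andP[u10 _] := au1.1 x; have /andP[_ u2T] := au2.1 x.
have := pow4_slope u10 (u12 x) u2T.
have := @le_radiation _ T g1 g2 x (admissible_continuous ag1) ag1.1
  (admissible_continuous ag2) ag2.1 g12.
rewrite /source; move: (radiation g1 x) (radiation g2 x) (u1 x) (u2 x) => h1 h2 s1 s2.
by move=> ? ?; lra.
Qed.

Lemma flux_continuous u g : admissible u -> admissible g -> continuous (flux u g).
Proof.
move=> au ag; apply: (@continuous_tail_resolvent _ _ (a * b * T) b0).
  exact: source_continuous.
by move=> x; exact: source_norm.
Qed.

Lemma flux_bounds u g x : admissible u -> admissible g -> 0 <= flux u g x <= a * T.
Proof.
move=> au ag; apply/andP; split.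
  by apply: tail_resolvent_ge0 => y; have /andP[] := source_bounds y au ag.
rewrite (_ : a * T = a * b * T / b); last by field; rewrite gt_eqF.
apply: tail_resolvent_le => //; first exact: source_continuous.
by move=> y; exact: source_bounds.
Qed.

Lemma profile_bounds u g y : admissible u -> admissible g -> 0 <= y ->
  T * expR (- a * y) <= profile u g y <= T.
Proof.
move=> au ag y0; apply/andP; split.
  apply: head_resolvent_ge => //; first exact: flux_continuous.
  by move=> x; have /andP[] := flux_bounds x au ag.
apply: head_resolvent_le => //; first exact: flux_continuous.
by move=> x; have /andP[] := flux_bounds x au ag.
Qed.

Lemma step_bounds u g y : admissible u -> admissible g -> 0 < step u g y <= T.
Proof.
move=> au ag; have y0 : 0 <= Num.max y 0 by rewrite le_max lexx orbT.
have /andP[h1 h2] := profile_bounds au ag y0; rewrite h2 andbT.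
by rewrite (lt_le_trans _ h1)// mulr_gt0// expR_gt0.
Qed.

Lemma is_derive_flux u g y : admissible u -> admissible g ->
  is_derive y 1 (flux u g) (b * flux u g y - source u g y).
Proof.
move=> au ag; apply: (@is_derive_tail_resolvent _ _ (a * b * T) b0).
  exact: source_continuous.
by move=> x; exact: source_norm.
Qed.

(** This and [profile2] are the first two derivatives of [profile], read off from the two
    first-order equations instead of by differentiating integrals. *)
Definition profile1 u g y := flux u g y - a * profile u g y.

Definition profile2 u g y := b * flux u g y - source u g y - a * profile1 u g y.

Lemma is_derive_profile u g y : admissible u -> admissible g -> 0 <= y ->
  is_derive y 1 (profile u g) (profile1 u g y).
Proof.
move=> au ag y0; apply: is_derive_head_resolvent; first exact: flux_continuous.
by rewrite (lt_le_trans _ y0)// ltrN10.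
Qed.

Lemma is_derive_profile1 u g y : admissible u -> admissible g -> 0 <= y ->
  is_derive y 1 (profile1 u g) (profile2 u g y).
Proof.
move=> au ag y0; apply: is_deriveB; first exact: is_derive_flux.
by apply: is_deriveZ; exact: is_derive_profile.
Qed.

(** The derivative is a difference of two quantities that both lie in [[0, a T]]. *)
Lemma profile1_norm u g y : admissible u -> admissible g -> 0 <= y ->
  `|profile1 u g y| <= a * T.
Proof.
move=> au ag y0; have /andP[f0 fT] := flux_bounds y au ag.
have /andP[p0 pT] := profile_bounds au ag y0.
have {}p0 : 0 <= profile u g y.
  by rewrite (le_trans _ p0)// mulr_ge0 ?expR_ge0 ?ltW.
rewrite /profile1; move: (flux u g y) (profile u g y) f0 fT p0 pT => f p f0 fT p0 pT.
have ap0 : 0 <= a * p by rewrite mulr_ge0// ltW.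
have apT : a * p <= a * T by rewrite ler_wpM2l// ltW.
by rewrite ler_norml; apply/andP; split; lra.
Qed.

Lemma profile2_norm u g y : admissible u -> admissible g -> 0 <= y ->
  `|profile2 u g y| <= 2 * (a * b * T) + a ^+ 2 * T.
Proof.
move=> au ag y0; have /andP[f0 fT] := flux_bounds y au ag.
have /andP[s0 sT] := source_bounds y au ag.
have := profile1_norm au ag y0.
rewrite /profile2; move: (flux u g y) (profile1 u g y) (source u g y) f0 fT s0 sT.
move=> f p s f0 fT s0 sT; rewrite ler_norml => /andP[p1 p2].
have bf0 : 0 <= b * f by rewrite mulr_ge0// ltW.
have bfT : b * f <= a * b * T.
  by rewrite [leRHS](_ : _ = b * (a * T)); [apply: ler_wpM2l => //; exact: ltW|ring].
have ap1 : - (a ^+ 2 * T) <= a * p.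
  by rewrite [leLHS](_ : _ = a * (- (a * T))); [apply: ler_wpM2l => //; exact: ltW|ring].
have ap2 : a * p <= a ^+ 2 * T.
  by rewrite [leRHS](_ : _ = a * (a * T)); [apply: ler_wpM2l => //; exact: ltW|ring].
by rewrite ler_norml; apply/andP; split; lra.
Qed.

(** The mean value inequality bounds the variation of the profile on the half-line, and
    [x |-> max x 0] is 1-Lipschitz. *)
Lemma step_admissible u g : admissible u -> admissible g -> admissible (step u g).
Proof.
move=> au ag; split=> [x|x y].
  by have /andP[/ltW-> ->] := step_bounds x au ag.
wlog xy : x y / x <= y => [h|].
  by have [/h//|/ltW/h] := leP x y; rewrite distrC (distrC x).
rewrite distrC; pose x' := Num.max x 0; pose y' := Num.max y 0.
have x'0 : 0 <= x' by rewrite le_max lexx orbT.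
have x'y' : x' <= y' by rewrite /x' /y' ge_max !le_max xy lexx !orbT.
have h : `|profile u g y' - profile u g x'| <= a * T * (y' - x').
  apply: (is_derive_lipschitz _ _ x'y') => z /andP[xz _].
    by apply: is_derive_profile => //; exact: le_trans xz.
  by apply: profile1_norm => //; exact: le_trans xz.
apply: (le_trans h); apply: ler_wpM2l; first by rewrite mulr_ge0// ltW.
rewrite distrC (le_trans _ (ler_norm _))// /x' /y'.
by case: (leP x 0); case: (leP y 0) => *; lra.
Qed.

Lemma stepE u g y : 0 <= y -> step u g y = profile u g y.
Proof. by move=> y0; rewrite /step max_l. Qed.

Lemma step0 u g : step u g 0 = T.
Proof. by rewrite /step maxxx /profile head_resolvent0. Qed.

Lemma le_step u1 u2 g1 g2 y : admissible u1 -> admissible u2 ->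
  admissible g1 -> admissible g2 ->
  (forall y, u1 y <= u2 y) -> (forall y, g1 y <= g2 y) ->
  step u1 g1 y <= step u2 g2 y.
Proof.
move=> au1 au2 ag1 ag2 u12 g12; apply: le_head_resolvent.
- exact: flux_continuous.
- exact: flux_continuous.
- move=> x; apply: (@le_tail_resolvent _ b (a * b * T)) => //.
  + exact: source_continuous.
  + by move=> z; exact: source_norm.
  + exact: source_continuous.
  + by move=> z; exact: source_norm.
  + by move=> z; exact: le_source.
- by rewrite le_max lexx orbT.
Qed.

(** Pointwise convergence suffices: the admissible bounds supply the domination at each of the three
    nested integrals. *)
Lemma cvg_step (u_ g_ : nat -> R -> R) u g y :
  (forall n, admissible (u_ n)) -> (forall n, admissible (g_ n)) ->
  (forall x, u_ n x @[n --> \oo] --> u x) ->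
  (forall x, g_ n x @[n --> \oo] --> g x) ->
  step (u_ n) (g_ n) y @[n --> \oo] --> step u g y.
Proof.
move=> au_ ag_ uu gg.
have au := cvg_admissible au_ uu; have ag := cvg_admissible ag_ gg.
apply: (@cvg_head_resolvent _ _ _ _ _ _ (a * T)).
- by move=> n; exact: flux_continuous.
- exact: flux_continuous.
- move=> n x; have /andP[f0 fT] := flux_bounds x (au_ n) (ag_ n).
  by rewrite ger0_norm.
- move=> x; apply: (@cvg_tail_resolvent _ b (a * b * T)) => //.
  + by move=> n; exact: source_continuous.
  + by move=> n z; exact: source_norm.
  + move=> z; apply: cvgD.
      apply: cvgB; first by apply: cvgMr; exact: uu.
      apply: (@cvg_comp _ _ _ (fun n => u_ n z) (fun t => t ^+ 4)).
        exact: uu.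
      exact: exprn_continuous.
    apply: (@cvg_radiation _ T) => //.
    * by move=> n; exact: admissible_continuous.
    * by move=> n; have [] := ag_ n.
    * exact: admissible_continuous.
- by rewrite le_max lexx orbT.
Qed.

End nonlinear.

(** * Regularity of fixed points of [step], and the inner iteration *)

Section classical_solution.
Context {R : realType}.

(** A two-sided derivative restricts to the one-sided limit at 0. Agreement is asked only on the
    half-line because [step], frozen for [y < 0], may have a kink at 0 while [profile] does not. *)
Lemma is_derive_deriv_Rplus (f F f1 : R -> R) :
  (forall y, 0 <= y -> f y = F y) ->
  (forall y : R, 0 <= y -> is_derive y 1 F (f1 y)) -> deriv_Rplus f f1.
Proof.
move=> fF dF y y0.
have [/cvg_ex[/= l Fl] F1] := dF y y0.
have lE : l = f1 y by rewrite -F1 /derive; apply/esym/cvg_lim.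
rewrite -lE; apply: (cvg_trans _ (cvg_within_filter [set h | 0 <= y + h] Fl)).
apply: near_eq_cvg; rewrite near_withinE; apply: nearW => h /= yh.
by rewrite (fF _ yh) (fF _ y0) /GRing.scale/= mulr1 [h + y]addrC.
Qed.

Lemma sqrt_holder_of_lipschitz (C x : R) : 0 <= C -> 0 <= x <= 1 ->
  C * x <= C * Num.sqrt x.
Proof.
move=> C0 /andP[x0 x1]; rewrite ler_wpM2l// -{1}(sqr_sqrtr x0) expr2.
by rewrite ler_piMr ?sqrtr_ge0// -sqrtr1 ler_wsqrtr.
Qed.

Variables a b T : R.
Hypotheses (T0 : 0 < T) (a0 : 0 < a) (ab : a <= b) (abT : 4 * T ^+ 3 <= a * b).
Implicit Types (u g : R -> R) (x y : R).

Local Notation admissible := (admissible a T).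
Local Notation step := (step a b T).

(** [K] bounds the second derivative. The three summands of [H] are the Hoelder constants, at
    distance at most 1, of [(b - a) u'], of [u^4] and of the radiation term. *)
Let K := 2 * (a * b * T) + a ^+ 2 * T.
Let H := (b - a) * K + a * b * (a * T) + 4 * T ^+ 4.

(** A sum of nonnegative terms that dominates every part of the norm; it depends on [a], [b], [T]
    only, which makes the bound uniform along the sequence. *)
Definition C2_bound := T + a * T + 2 * K + H.

Let K0 : 0 <= K.
Proof. by rewrite addr_ge0 ?mulr_ge0 ?sqr_ge0 ?ltW// (lt_le_trans a0). Qed.

Let H0 : 0 <= H.
Proof.
have [T0' a0'] := (ltW T0, ltW a0); have b0' := le_trans a0' ab.
by rewrite !addr_ge0 ?mulr_ge0 ?exprn_ge0 ?subr_ge0.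
Qed.

(** On the half-line a fixed point equals its own profile. Eliminating the flux from [profile1] and
    [profile2] cancels the terms [a b u] and leaves [u'' = (b - a) u' + u^4 - h], with [h] the
    radiation term, from which the Hoelder bound is read. *)
Lemma fixpoint_solves u g : admissible u -> admissible g -> u = step u g ->
  exists f1 f2, C2beta_bound u f1 f2 2^-1 C2_bound /\ solves_eq (b - a) u f1 f2 g.
Proof.
move=> au ag uE.
pose p1 := profile1 a b T u g; pose p2 := profile2 a b T u g.
have up y : 0 <= y -> u y = profile a b T u g y.
  by move=> y0; rewrite {1}uE stepE.
have p2E y : 0 <= y -> p2 y = (b - a) * p1 y + (u y ^+ 4 - radiation g y).
  move=> y0; rewrite /p2 /p1 /profile2 /source /profile1 -up//.
  by move: (flux _ _ _ _ _) (radiation _ _) (u y) => *; ring.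
have aT0 : 0 <= a * T by rewrite mulr_ge0 ?ltW.
exists p1, p2; split; last first.
  move=> y y0; rewrite (EintE y (admissible_continuous ag) ag.1) -EFinN.
  congr EFin; rewrite (p2E y (ltW y0)).
  by move: (p1 y) (radiation _ _) (u y) => *; ring.
have K2 y : 0 <= y -> `|p2 y| <= K by exact: profile2_norm.
have M0 : K <= C2_bound /\ 2 * K + H <= C2_bound.
  by rewrite /C2_bound; split; have := K0; have := H0; move: K H aT0 T0 => *; lra.
split.
- by apply: (is_derive_deriv_Rplus up) => y y0; exact: is_derive_profile.
- by apply: (is_derive_deriv_Rplus (F := p1)) => // y y0; exact: is_derive_profile1.
- move=> x x0; split.
  + have /andP[ux0 uxT] := au.1 x; rewrite ger0_norm//.
    by rewrite /C2_bound; have := K0; have := H0; move: K H aT0 T0 => *; lra.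
  + apply: (le_trans (profile1_norm T0 a0 ab abT au ag x0)).
    by rewrite /C2_bound; have := K0; have := H0; move: K H aT0 T0 => *; lra.
  + exact: le_trans (K2 x x0) M0.1.
move=> x y x0 y0 xy.
have s0 : 0 < Num.sqrt `|x - y| by rewrite sqrtr_gt0 normr_gt0 subr_eq0.
rewrite powR12_sqrt// ler_pdivrMr//.
apply: (@le_trans _ _ ((2 * K + H) * Num.sqrt `|x - y|)); last first.
  by rewrite ler_wpM2r ?M0.2// ltW.
rewrite mulrDl.
(* Beyond distance 1 the sup bound [2 K] suffices; at distance at most 1 the Lipschitz bounds on
   [u'] and [u^4] imply Hoelder bounds with the same constants. *)
have [d1|d1] := leP `|x - y| 1; last first.
  have s1 : 1 <= Num.sqrt `|x - y| by rewrite -[leLHS]sqrtr1 ler_wsqrtr// ltW.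
  apply: (le_trans (ler_normB _ _)).
  have := K2 x x0; have := K2 y y0; have := K0.
  have := mulr_ge0 H0 (ltW s0).
  move: `|p2 x| `|p2 y| (Num.sqrt _) K H s1 => n1 n2 s k h s1 *; nra.
have hd : 0 <= `|x - y| <= 1 by rewrite normr_ge0.
have p1L : `|p1 x - p1 y| <= K * `|x - y|.
  have p1L z w : 0 <= w -> w <= z -> `|p1 z - p1 w| <= K * `|z - w|.
    move=> w0 wz; rewrite (ger0_norm (_ : 0 <= z - w)) ?subr_ge0//.
    apply: (is_derive_lipschitz (f := p2) _ _ wz) => v /andP[wv _].
      by apply: is_derive_profile1 => //; exact: le_trans wv.
    by apply: K2; exact: le_trans wv.
  have [yx|/ltW yx] := leP y x; first exact: p1L.
  by rewrite distrC [`|x - y|]distrC; exact: p1L.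
have u4L : `|u x ^+ 4 - u y ^+ 4| <= a * b * (a * T) * `|x - y|.
  apply: (le_trans (pow4_lipschitz abT (au.1 y) (au.1 x))).
  rewrite -[leRHS]mulrA; apply: ler_wpM2l; last exact: au.2.
  by rewrite mulr_ge0 ?(ltW a0)// (le_trans (ltW a0)).
have rL := radiation_holder x y (admissible_continuous ag) ag.1.
rewrite (p2E x x0) (p2E y y0).
rewrite [X in `|X|](_ : _ = (b - a) * (p1 x - p1 y) +
   (u x ^+ 4 - u y ^+ 4) - (radiation g x - radiation g y)); last first.
  by move: (radiation g x) (radiation g y) (p1 x) (p1 y) => *; ring.
apply: (le_trans (ler_normB _ _)).
apply: (@le_trans _ _ (H * Num.sqrt `|x - y|)); last first.
  by rewrite lerDr !mulr_ge0// ltW.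
rewrite /H [leRHS]mulrDl; apply: lerD; last exact: rL.
apply: (le_trans (ler_normD _ _)); rewrite [leRHS]mulrDl; apply: lerD.
  rewrite normrM ger0_norm ?subr_ge0// -mulrA ler_wpM2l ?subr_ge0//.
  exact: le_trans p1L (sqrt_holder_of_lipschitz K0 hd).
apply: (le_trans u4L); apply: sqrt_holder_of_lipschitz => //.
have [T0' a0'] := (ltW T0, ltW a0); have b0' := le_trans a0' ab.
by rewrite !mulr_ge0.
Qed.

Lemma nondecreasing_admissible_cvg (u_ : nat -> R -> R) :
  (forall n, admissible (u_ n)) -> (forall n x, u_ n x <= u_ n.+1 x) ->
  forall x, u_ n x @[n --> \oo] --> limn (u_ ^~ x).
Proof.
move=> au_ u_nd x; apply: nondecreasing_is_cvgn.
  by apply/nondecreasing_seqP => n; exact: u_nd.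
by exists T => _ [n _ <-]; have /andP[] := (au_ n).1 x.
Qed.

Definition iterate g n : R -> R := iter n (step ^~ g) (cst 0).

Definition minimal_solution g y : R := limn (fun n => iterate g n y).

Lemma iterate_admissible g n : admissible g -> admissible (iterate g n).
Proof.
by move=> ag; elim: n => [|n IHn]; [exact: admissible0|exact: step_admissible].
Qed.

Lemma iterate_nondecreasing g n x : admissible g ->
  iterate g n x <= iterate g n.+1 x.
Proof.
move=> ag; elim: n x => [|n IHn] x.
  by have /andP[] := (@iterate_admissible g 1 ag).1 x.
have an := iterate_admissible n ag; have anS := iterate_admissible n.+1 ag.
exact: (le_step a0 ab abT x an anS ag ag IHn (fun=> lexx _)).
Qed.

Lemma cvg_iterate g x : admissible g ->
  iterate g n x @[n --> \oo] --> minimal_solution g x.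
Proof.
move=> ag; apply: nondecreasing_admissible_cvg => [n|n y].
  exact: iterate_admissible.
exact: iterate_nondecreasing.
Qed.

Lemma minimal_solution_admissible g : admissible g -> admissible (minimal_solution g).
Proof.
move=> ag; apply: (@cvg_admissible _ _ _ (iterate g)) => [n|x].
  exact: iterate_admissible.
exact: cvg_iterate.
Qed.

(** Both sides are limits of the same shifted sequence of iterates, by continuity of [step] under
    pointwise limits. *)
Lemma minimal_solution_fixpoint g : admissible g ->
  minimal_solution g = step (minimal_solution g) g.
Proof.
move=> ag; apply/funext => y.
apply: (@cvg_unique R (@norm_hausdorff _ _) (iterate g n.+1 y @[n --> \oo])).
  by have := @cvg_iterate g y ag; rewrite -cvg_shiftS.
apply: (cvg_step a0 ab abT) => // [n|x|x].
- exact: iterate_admissible.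
- exact: cvg_iterate.
- exact: cvg_cst.
Qed.

(** Both inner iterations start from 0, so [le_step] orders them term by term, and the order passes
    to the limits. *)
Lemma le_minimal_solution g1 g2 x : admissible g1 -> admissible g2 ->
  (forall x, g1 x <= g2 x) -> minimal_solution g1 x <= minimal_solution g2 x.
Proof.
move=> ag1 ag2 g12.
have h n y : iterate g1 n y <= iterate g2 n y.
  elim: n y => [|n IHn] y; first exact: lexx.
  have an1 := iterate_admissible n ag1; have an2 := iterate_admissible n ag2.
  exact: (le_step a0 ab abT y an1 an2 ag1 ag2 IHn g12).
apply: (ler_cvg_to (@cvg_iterate g1 x ag1) (@cvg_iterate g2 x ag2)).
by apply: nearW => n; exact: h.
Qed.

End classical_solution.

(** * The outer iteration and its limit *)

Theorem theorem2p3 (R : realType) (TM c : R) (hTM : 0 < TM) (hc : 0 < c) :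
  exists (f : R -> R) (F : nat -> R -> R),
    (* the solution f *)
    [/\ (exists (f1 f2 : R -> R) (M : R), C2beta_bound f f1 f2 (2^-1) M
                                          /\ solves_eq c f f1 f2 f),
        (forall y, 0 < y -> 0 < f y),
        f 0 = TM &
        (forall y, 0 <= y -> 0 <= f y)]
    /\
    (* the approximating sequence f_n *)
    [/\ F 0%N = (fun _ => 0),
        (exists M : R, forall n : nat,
            exists f1 f2 : R -> R,
              C2beta_bound (F n.+1) f1 f2 (2^-1) M
              /\ solves_eq c (F n.+1) f1 f2 (F n)),
        (forall n, (forall y, 0 < y -> 0 < F n.+1 y) /\ F n.+1 0 = TM),
        (forall n y, 0 <= y -> 0 <= F n y /\ F n y <= F n.+1 y /\ F n.+1 y <= TM) &
        (forall y, 0 <= y -> F n y @[n --> \oo] --> f y)].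
Proof.
(* Then [b - a = c], and [a >= 4 TM^3] with [b >= a >= 1] gives [a b >= 4 TM^3]. *)
pose a := 1 + 4 * TM ^+ 3; pose b := a + c.
have T3 : 0 < 4 * TM ^+ 3 by rewrite mulr_gt0// exprn_gt0.
have a0 : 0 < a by rewrite addr_gt0.
have ab : a <= b by rewrite lerDl ltW.
have abT : 4 * TM ^+ 3 <= a * b.
  apply: (@le_trans _ _ a); first by rewrite lerDr.
  by rewrite ler_peMr ?(ltW a0)// (le_trans _ ab)// lerDl ltW.
have cE : c = b - a by rewrite addrC addKr.
pose F n := iter n (minimal_solution a b TM) (fun=> 0).
have aF n : admissible a TM (F n).
  elim: n => [|n IHn]; first exact: admissible0.
  exact: minimal_solution_admissible.
have FE n : F n.+1 = step a b TM (F n.+1) (F n) by exact: minimal_solution_fixpoint.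
have F_nd n y : F n y <= F n.+1 y.
  elim: n y => [|n IHn] y; first by have /andP[] := (aF 1%N).1 y.
  exact: (le_minimal_solution hTM a0 ab abT y (aF n) (aF n.+1) IHn).
pose f y : R := limn (F ^~ y).
have Ff y : F n y @[n --> \oo] --> f y.
  exact: (nondecreasing_admissible_cvg aF F_nd).
have af : admissible a TM f by exact: cvg_admissible Ff.
(* In [F n.+1 = step (F n.+1) (F n)] both arguments converge to [f], the first by shifting the
   index. *)
have fE : f = step a b TM f f.
  apply/funext => y.
  apply: (@cvg_unique R (@norm_hausdorff _ _) (F n.+1 y @[n --> \oo])).
    by have := Ff y; rewrite -cvg_shiftS.
  rewrite (_ : (fun n => F n.+1 y) = (fun n => step a b TM (F n.+1) (F n) y)).
    apply: (cvg_step a0 ab abT) => // x.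
    by have := Ff x; rewrite -cvg_shiftS.
  by apply/funext => n; rewrite {1}FE.
exists f, F; split; split.
- have [f1 [f2 h]] := fixpoint_solves hTM a0 ab abT af af fE.
  by exists f1, f2, (C2_bound a b TM); rewrite cE.
- by move=> y _; rewrite fE; have /andP[] := step_bounds hTM a0 ab abT y af af.
- by rewrite fE step0.
- by move=> y _; have /andP[] := af.1 y.
- by [].
- exists (C2_bound a b TM) => n; rewrite cE.
  exact: (fixpoint_solves hTM a0 ab abT (aF n.+1) (aF n) (FE n)).
- move=> n; split=> [y _|]; last by rewrite FE step0.
  by rewrite FE; have /andP[] := step_bounds hTM a0 ab abT y (aF n.+1) (aF n).
- move=> n y _; split; first by have /andP[] := (aF n).1 y.
  by split; [exact: F_nd|have /andP[] := (aF n.+1).1 y].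
- by move=> y _; exact: Ff.
Qed.
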